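(* Let $X$ be a max-stable random sup-measure on $E$ with tail dependence functional $\ell$, and let $$\mathbf M=\Big\{\mu\ \text{Radon measure on } E:\ \int f\,d\mu\le\ell(f)\ \text{for all } f\in\mathrm{USC}\Big\}.$$ Then $\mathbf M$ is convex and $$\ell(f)=\sup_{\mu\in\mathbf M}\int f\,d\mu\qquad\text{for all } f\in\mathrm{USC}.$$
   Context: $E$ is a locally compact Hausdorff second countable space; $\mathcal K$ its compact subsets. A sup-measure on $E$ is a Choquet capacity $\varphi$ (non-decreasing, $\varphi(\emptyset)=0$, $\varphi(A_n)\uparrow\varphi(A)$ if $A_n\uparrow A$, $\varphi(K_n)\downarrow\varphi(K)$ for compact $K_n\downarrow K$), finite on compacts, with $\varphi(\bigcup_j G_j)=\sup_j\varphi(G_j)$ for all families of open sets; a random sup-measure is a random element of the space of sup-measures (Borel $\sigma$-algebra of the sup-vague topology). $\mathrm{USC}$: bounded non-negative upper semicontinuous functions on $E$ with relatively compact support. Extremal integral $\int^e f\,d\varphi=\sup\{\varphi(K)\inf_{x\in K}f(x):K\in\mathcal K\}$. Unit Fréchet with scale $a\ge0$: distribution function $\exp(-a/t)$, $t>0$. $X$ is max-stable if $\bigvee_iu_iX(K_i)$ is unit Fréchet for all $K_1,\dots,K_m\in\mathcal K$, $u_i\ge0$; tail dependence functional $\ell(f)$ = scale parameter of $\int^e f\,dX$. *)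

(* Defs.v *)
From HB Require Import structures.
From mathcomp Require Import all_boot all_order all_algebra.
From mathcomp Require Import all_classical all_reals all_analysis measurable_realfun lebesgue_integral.
Set Implicit Arguments. Unset Strict Implicit. Unset Printing Implicit Defensive.
Import Order.TTheory GRing.Theory Num.Theory.
Local Open Scope classical_set_scope.
Local Open Scope ring_scope.
Local Open Scope ereal_scope.

Definition lchs (E : ptopologicalType) : Prop :=
  [/\ locally_compact [set: E], hausdorff_space E & @second_countable E].

Definition borelE (E : ptopologicalType) : measurableType (@open E).-sigma :=
  g_sigma_algebraType (@open E).

Definition sup_measure {R : realType} {E : ptopologicalType}
    (phi : set E -> \bar R) : Prop :=
  [/\ (forall A B, A `<=` B -> phi A <= phi B) /\ phi set0 = 0,
      (forall A : nat -> set E, (forall n, A n `<=` A n.+1) ->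
          phi (A n) @[n --> \oo] --> phi (\bigcup_(n : nat) A n)),
      (forall K : nat -> set E, (forall n, compact (K n)) ->
          (forall n, K n.+1 `<=` K n) ->
          phi (K n) @[n --> \oo] --> phi (\bigcap_(n : nat) K n)),
      (forall K, compact K -> phi K < +oo) &
      (forall G : set (set E), G !=set0 -> (forall U, G U -> open U) ->
          phi (\bigcup_(U in G) U) = ereal_sup (phi @` G))].

(* A random sup-measure: a map Omega -> sup-measures which is measurable for
   the sigma-algebra generated by the evaluations at compact and open sets
   (this is the Borel sigma-algebra of the sup-vague topology). *)
Definition random_sup_measure {R : realType} {E : ptopologicalType}
    {dO : measure_display} {O : measurableType dO}
    (X : O -> set E -> \bar R) : Prop :=
  [/\ (forall w, sup_measure (X w)),
      (forall K, compact K -> measurable_fun [set: O] (fun w => X w K)) &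
      (forall G, open G -> measurable_fun [set: O] (fun w => X w G))].

Definition frechet_scale {R : realType} {dO : measure_display}
    {O : measurableType dO} (P : probability O R) (Y : O -> \bar R) (a : R)
    : Prop :=
  (0 <= a)%R /\ forall t : R, (0 < t)%R ->
    measurable [set w | Y w <= t%:E] /\
    P [set w | Y w <= t%:E] = (expR (- (a / t)))%:E.

Definition unit_frechet {R : realType} {dO : measure_display}
    {O : measurableType dO} (P : probability O R) (Y : O -> \bar R) : Prop :=
  exists a : R, frechet_scale P Y a.

Definition max_stable {R : realType} {E : ptopologicalType}
    {dO : measure_display} {O : measurableType dO} (P : probability O R)
    (X : O -> set E -> \bar R) : Prop :=
  forall (m : nat) (K : 'I_m -> set E) (u : 'I_m -> R),
    (forall i, compact (K i)) -> (forall i, (0 <= u i)%R) ->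
    unit_frechet P (fun w => \big[maxe/0]_(i < m) ((u i)%:E * X w (K i))).

Definition USC {R : realType} {E : ptopologicalType} (f : E -> R) : Prop :=
  [/\ (forall x, (0 <= f x)%R),
      (exists M : R, forall x, (f x <= M)%R),
      (forall t : R, open [set x | (f x < t)%R]) &
      precompact [set x | f x != 0%R]].

Definition ext_integral {R : realType} {E : ptopologicalType}
    (f : E -> R) (phi : set E -> \bar R) : \bar R :=
  ereal_sup [set phi K * ereal_inf [set (f x)%:E | x in K] | K in compact].

Definition tail_dependence {R : realType} {E : ptopologicalType}
    {dO : measure_display} {O : measurableType dO} (P : probability O R)
    (X : O -> set E -> \bar R) (l : (E -> R) -> R) : Prop :=
  forall f, USC f -> frechet_scale P (fun w => ext_integral f (X w)) (l f).

(* Radon measures on E (Borel measures finite on compacts; on an LCH second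
   countable space these are exactly the Radon measures). *)
Definition radon {R : realType} {E : ptopologicalType}
    (mu : {measure set (borelE E) -> \bar R}) : Prop :=
  forall K : set E, compact K -> mu K < +oo.

Definition convex_measures {R : realType} {E : ptopologicalType}
    (M : set {measure set (borelE E) -> \bar R}) : Prop :=
  forall (mu nu rho : {measure set (borelE E) -> \bar R}) (l : R),
    M mu -> M nu -> (0 <= l <= 1)%R ->
    (forall A, measurable A -> rho A = l%:E * mu A + (1 - l)%:E * nu A) ->
    M rho.

(* Main.v *)
Require Import Defs.
From HB Require Import structures.
From mathcomp Require Import all_boot all_order all_algebra finmap.
From mathcomp Require Import all_classical all_reals all_analysis measurable_realfun lebesgue_integral.
From mathcomp Require Import ring lra.
Set Implicit Arguments. Unset Strict Implicit. Unset Printing Implicit Defensive.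
Import Order.TTheory GRing.Theory Num.Theory.
Local Open Scope classical_set_scope.
Local Open Scope ring_scope.

(* For a sup-measure phi the extremal integral is sup_x f(x) phi({x}), hence it
   is subadditive in f. Truncated counting expectations turn this into the
   subadditivity of the scale of the Frechet variable given by the extremal
   integral of f, so l is sublinear, and outer continuity of phi on compacts
   passes to l along step functions. Fix f0 in USC. Hahn-Banach gives a linear
   L <= l with L f0 = l f0 on the span of the bounded functions with relatively
   compact support; K |-> L 1_K is a content on compacts and induces a Radon
   measure mu with mu K >= L 1_K for K compact and mu G <= L 1_C for G open in a
   compact C. Slicing f into superlevel sets gives int f dmu >= L f from the
   first bound; the second one, applied to neighbourhoods shrinking to the
   superlevel sets, gives int f dmu <= l f. *)

(** * Hahn-Banach theorem on a subspace *)

Section HahnBanach.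
Context {R : realType} {V : lmodType R}.
Variable D : set V.
Hypothesis DD : forall u v, D u -> D v -> D (u + v).
Hypothesis DZ : forall a u, D u -> D (a *: u).
Implicit Types (p q : V -> R) (u v : V) (a t : R).

(** Homogeneity is asked only as an inequality, the form that passes to infima; [sublinear_onZ]
    recovers equality by using it for [a] and for its inverse. *)
Definition sublinear_on q :=
  (forall u v, D u -> D v -> q (u + v) <= q u + q v) /\
  (forall a u, 0 <= a -> D u -> q (a *: u) <= a * q u).

Lemma sublinear_on0 q u : D u -> sublinear_on q -> q 0 = 0.
Proof.
move=> Du [qD qZ]; have D0 : D 0 by rewrite -(scale0r u); exact: DZ.
have h := qD _ _ D0 D0; have := qZ 0 _ (lexx 0) D0.
rewrite addr0 in h; rewrite scale0r mul0r; lra.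
Qed.

Lemma sublinear_onZ q a u : sublinear_on q -> 0 <= a -> D u ->
  q (a *: u) = a * q u.
Proof.
move=> sq; rewrite le_eqVlt => /orP[/eqP<-|a0] Du.
  by rewrite scale0r mul0r (sublinear_on0 Du).
have [qD qZ] := sq.
apply/eqP; rewrite eq_le qZ ?(ltW a0)//= -ler_pdivlMl//.
by rewrite -[in leLHS](scalerK (lt0r_neq0 a0) u) qZ ?invr_ge0 ?ltW//; exact: DZ.
Qed.

Lemma sublinear_onN q u : sublinear_on q -> D u -> - q (- u) <= q u.
Proof.
move=> sq Du; have DN : D (- u) by rewrite -scaleN1r; exact: DZ.
by have := sq.1 _ _ Du DN; rewrite subrr (sublinear_on0 Du sq); lra.
Qed.

(** The lower bound does not depend on [q], so pointwise infima of sublinear functionals below [p]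
    are finite. *)
Lemma sublinear_on_below q p u : sublinear_on q ->
  (forall v, D v -> q v <= p v) -> D u -> - p (- u) <= q u.
Proof.
move=> sq qp Du; apply: le_trans (sublinear_onN sq Du).
by rewrite lerN2 qp// -scaleN1r; exact: DZ.
Qed.

Let slope q h u := [set q (u + t *: h) - t * q h | t in [set t | 0 <= t]].

(* The largest sublinear [r <= q] such that [r (- h) <= - q h]; a minimal
   sublinear functional is therefore odd, hence linear. *)
Let straighten q h u := inf (slope q h u).

Let slope_lb q h u : sublinear_on q -> D h -> D u ->
  lbound (slope q h u) (- q (- u)).
Proof.
move=> sq Dh Du _ [t /= t0 <-].
have DN : D (- u) by rewrite -scaleN1r; exact: DZ.
have Dth : D (u + t *: h) by apply: DD => //; exact: DZ.
have := sq.1 _ _ Dth DN; rewrite addrAC subrr add0r.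
by rewrite (sublinear_onZ sq t0 Dh); lra.
Qed.

Let slope_neq0 q h u : slope q h u !=set0.
Proof. by exists (q (u + 0 *: h) - 0 * q h); exists 0 => /=. Qed.

Let straighten_le q h u t : sublinear_on q -> D h -> D u -> 0 <= t ->
  straighten q h u <= q (u + t *: h) - t * q h.
Proof.
move=> sq Dh Du t0; apply: ge_inf; last by exists t.
by exists (- q (- u)); exact: slope_lb.
Qed.

(** Parameters [t] for [u] and [s] for [v] combine into [t + s] for [u + v], and [t] for [u] becomes
    [a * t] for [a *: u]. *)
Let straighten_sublinear q h : sublinear_on q -> D h ->
  sublinear_on (straighten q h).
Proof.
move=> sq Dh; split=> [u v Du Dv|a u].
  rewrite -lerBlDr; apply: lb_le_inf => // _ [t /= t0 <-].
  rewrite lerBlDr -lerBlDl; apply: lb_le_inf => // _ [s /= s0 <-].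
  rewrite lerBlDl; apply: le_trans.
    apply: (straighten_le sq Dh (DD Du Dv) (addr_ge0 t0 s0)).
  have /(sq.1 _ _) := DD Du (DZ t Dh) => /(_ _ (DD Dv (DZ s Dh))).
  by rewrite scalerDl addrACA mulrDl; lra.
rewrite le_eqVlt => /orP[/eqP<- Du|a0 Du].
  rewrite scale0r mul0r; have D0 : D 0 by rewrite -(scale0r u); exact: DZ.
  have := straighten_le sq Dh D0 (lexx 0).
  by rewrite scale0r addr0 mul0r subr0 (sublinear_on0 Du sq).
rewrite -ler_pdivrMl//; apply: lb_le_inf => // _ [t /= t0 <-].
rewrite ler_pdivrMl//.
have at0 : 0 <= a * t by rewrite mulr_ge0 ?(ltW a0).
have := straighten_le sq Dh (DZ a Du) at0.
rewrite -scalerA -scalerDr (sublinear_onZ sq (ltW a0)) ?mulrBr ?mulrA//.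
by apply: DD => //; exact: DZ.
Qed.

Let straighten_le_id q h u : sublinear_on q -> D h -> D u ->
  straighten q h u <= q u.
Proof.
move=> sq Dh Du; have := straighten_le sq Dh Du (lexx 0).
by rewrite scale0r addr0 mul0r subr0.
Qed.

Let straighten_opp q h : sublinear_on q -> D h ->
  straighten q h (- h) <= - q h.
Proof.
move=> sq Dh; have DN : D (- h) by rewrite -scaleN1r; exact: DZ.
have := straighten_le sq Dh DN ler01.
by rewrite scale1r addNr mul1r (sublinear_on0 Dh sq) sub0r.
Qed.

Let dominated p := {q | sublinear_on q /\ forall u, D u -> q u <= p u}.

(** Zorn's lemma for the reversed pointwise order. A nonempty chain is bounded by its pointwise
    infimum, which is subadditive because the smaller of two members serves both arguments; the
    empty chain is bounded by [p]. *)
Let minimal_sublinear p : sublinear_on p ->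
  exists2 q, sublinear_on q /\ (forall u, D u -> q u <= p u) &
    forall r, sublinear_on r -> (forall u, D u -> r u <= q u) ->
      forall u, D u -> q u <= r u.
Proof.
move=> sp; pose below (s t : dominated p) := `[< forall u, D u -> sval t u <= sval s u >].
have p_p : sublinear_on p /\ forall u, D u -> p u <= p u by [].
have [|r s t /asboolP rs /asboolP st| |[q qP] qmin] :=
    @ZL_preorder (dominated p) (exist _ p p_p) below.
- by move=> t; apply/asboolP.
- by apply/asboolP => u Du; apply: le_trans (rs _ Du); exact: st.
- move=> A Atot; have [[q0 Aq0]|A0] := pselect (A !=set0); last first.
    by exists (exist _ p p_p) => s As; exfalso; apply: A0; exists s.
  pose vals u := [set sval s u | s in A].
  have vals_neq0 u : vals u !=set0 by exists (sval q0 u), q0.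
  have vals_lb u : D u -> lbound (vals u) (- p (- u)).
    by move=> Du _ [s As <-]; case: (svalP s) => ss sle; exact: sublinear_on_below.
  have infle s u : A s -> D u -> inf (vals u) <= sval s u.
    by move=> As Du; apply: ge_inf; [exists (- p (- u)); exact: vals_lb|exists s].
  have inf_sub : sublinear_on (fun u => inf (vals u)).
    split=> [u v Du Dv|a u].
      rewrite -lerBlDr; apply: lb_le_inf => // _ [s As <-].
      rewrite lerBlDr -lerBlDl; apply: lb_le_inf => // _ [t At <-].
      rewrite lerBlDl; have [/asboolP st|/asboolP ts] := Atot _ _ As At.
        apply: (le_trans (infle _ _ At (DD Du Dv))).
        apply: (le_trans ((svalP t).1.1 _ _ Du Dv)).
        by rewrite lerD2r; exact: st.
      apply: (le_trans (infle _ _ As (DD Du Dv))).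
      apply: (le_trans ((svalP s).1.1 _ _ Du Dv)).
      by rewrite lerD2l; exact: ts.
    rewrite le_eqVlt => /orP[/eqP<- Du|a0 Du].
      rewrite mul0r; apply: (le_trans (infle _ _ Aq0 (DZ 0 Du))).
      by rewrite scale0r (sublinear_on0 Du (svalP q0).1).
    rewrite -ler_pdivrMl//; apply: lb_le_inf => // _ [s As <-].
    rewrite ler_pdivrMl//; apply: (le_trans (infle _ _ As (DZ a Du))).
    by apply: (svalP s).1.2 => //; exact: ltW.
  have inf_le_p u : D u -> inf (vals u) <= p u.
    by move=> Du; apply: (le_trans (infle _ _ Aq0 Du)); exact: (svalP q0).2.
  exists (exist _ (fun u => inf (vals u)) (conj inf_sub inf_le_p)) => s As.
  by apply/asboolP => u Du; exact: infle.
exists q => // r sr rq.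
have rp u : D u -> r u <= p u.
  by move=> Du; apply: (le_trans (rq _ Du)); exact: qP.2.
have /(qmin (exist _ r (conj sr rp)))/asboolP : below (exist _ q qP) (exist _ r (conj sr rp)).
  by apply/asboolP.
exact.
Qed.

Lemma hahn_banach_on p v0 : sublinear_on p -> D v0 ->
  exists L : V -> R,
    [/\ (forall u v, D u -> D v -> L (u + v) = L u + L v),
        (forall a u, D u -> L (a *: u) = a * L u),
        (forall u, D u -> L u <= p u) & L v0 = p v0].
Proof.
move=> sp Dv0.
have DN u : D u -> D (- u) by move=> Du; rewrite -scaleN1r; exact: DZ.
(* Starting from [straighten p v0] instead of [p] forces [q (- v0) <= - p v0]; once [q] is odd this
   reads [p v0 <= q v0]. *)
have [q [sq qle] qmin] := minimal_sublinear (straighten_sublinear sp Dv0).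
(* Minimality compares [q] with [straighten q u], whose value at [- u] is at most [- q u]. *)
have qN u : D u -> q (- u) = - q u.
  move=> Du; apply/eqP; rewrite eq_le; apply/andP; split.
    apply: le_trans (straighten_opp sq Du).
    apply: (qmin _ (straighten_sublinear sq Du)); last exact: DN.
    by move=> v Dv; exact: straighten_le_id.
  by have := sublinear_onN sq Du; rewrite lerNl.
have qp u : D u -> q u <= p u.
  by move=> Du; apply: (le_trans (qle _ Du)); exact: straighten_le_id.
exists q; split => // [u v Du Dv|a u Du|].
- apply/eqP; rewrite eq_le sq.1//=.
  have := sq.1 _ _ (DN _ Du) (DN _ Dv).
  by rewrite -opprD !qN//; [lra|exact: DD].
- have [a0|a0] := leP 0 a; first exact: sublinear_onZ.
  rewrite -[a]opprK scaleNr qN; last exact: DZ.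
  by rewrite sublinear_onZ// ?mulNr// oppr_ge0 ltW.
- apply/eqP; rewrite eq_le qp//=.
  have := qle _ (DN _ Dv0); rewrite qN// => /le_trans/(_ (straighten_opp sp Dv0)).
  by rewrite lerN2.
Qed.

End HahnBanach.

(** * Frechet scales *)

Section Frechet.
Context {R : realType} {dO : measure_display} {O : measurableType dO}.
Variable P : probability O R.
Implicit Types (Y Z : O -> \bar R) (a b c : R).
Local Open Scope ereal_scope.

(** At level [1] the event for [Z] lies in the one for [Y], so [expR (- b) <= expR (- a)]. *)
Lemma frechet_scale_mono Y Z a b : (forall w, Y w <= Z w) ->
  frechet_scale P Y a -> frechet_scale P Z b -> (a <= b)%R.
Proof.
move=> YZ [_ FY] [_ FZ].
have [[mY PY] [mZ PZ]] := (FY _ ltr01, FZ _ ltr01).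
have : P [set w | Z w <= 1%R%:E] <= P [set w | Y w <= 1%R%:E].
  by apply: le_measure; rewrite ?inE// => w; apply: le_trans; exact: YZ.
by rewrite PY PZ lee_fin ler_expR lerN2 !divr1.
Qed.

Lemma frechet_scaleM Y a c : (0 < c)%R -> frechet_scale P Y a ->
  frechet_scale P (fun w => c%:E * Y w) (c * a)%R.
Proof.
move=> c0 [a0 FY]; split=> [|t t0]; first by rewrite mulr_ge0// ltW.
have -> : [set w | c%:E * Y w <= t%:E] = [set w | Y w <= (t / c)%:E].
  by apply/seteqP; split => w /=; rewrite -lee_pdivlMl// -EFinM mulrC.
have [mY PY] := FY _ (divr_gt0 t0 c0); split => //.
by rewrite PY; congr (expR (- _))%:E; field; rewrite !gt_eqF.
Qed.

(** The events [Z n <= t] increase and for [t > 1] their union contains [Y <= 1]. Continuity from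
    below gives [expR (- a) <= expR (- (b / t))], hence [b <= t * a], and [t] may be taken
    arbitrarily close to [1]. *)
Lemma frechet_scale_semicont Y (Z : nat -> O -> \bar R) a b :
  frechet_scale P Y a -> (forall n, exists2 c, (b <= c)%R & frechet_scale P (Z n) c) ->
  (forall w n, Z n.+1 w <= Z n w) ->
  (forall w s t, (0 < s)%R -> (s < t)%R -> Y w <= s%:E -> exists n, Z n w <= t%:E) ->
  (b <= a)%R.
Proof.
move=> [a0 FY] FZ Zdec YZ.
have [b0|b0] := ltP b 0%R; first exact: le_trans (ltW b0) a0.
have key t : (1 < t)%R -> (b <= t * a)%R.
  move=> t1; have t0 : (0 < t)%R := lt_trans ltr01 t1.
  have mZ n : measurable [set w | Z n w <= t%:E].
    by have [c _ [_ /(_ _ t0)[]]] := FZ n.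
  have PZ n : P [set w | Z n w <= t%:E] <= (expR (- (b / t)))%:E.
    have [c bc [_ /(_ _ t0)[_ ->]]] := FZ n.
    by rewrite lee_fin ler_expR lerN2 ler_pM2r ?invr_gt0.
  have mU : measurable (\bigcup_n [set w | Z n w <= t%:E]).
    exact: bigcup_measurable.
  have PU : P (\bigcup_n [set w | Z n w <= t%:E]) <= (expR (- (b / t)))%:E.
    have := nondecreasing_cvg_mu (mu := P) mZ mU.
    have Zinc : nondecreasing_seq (fun n => [set w | Z n w <= t%:E]).
      apply/nondecreasing_seqP => n; apply/subsetPset => w /=.
      by apply: le_trans; exact: Zdec.
    move=> /(_ Zinc) cvgP; rewrite -(cvg_lim _ cvgP)//.
    apply: lime_le; first by apply/cvg_ex; eexists; exact: cvgP.
    by apply: nearW => n; exact: PZ.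
  have [mY PY] := FY _ ltr01.
  have : P [set w | Y w <= 1%R%:E] <= P (\bigcup_n [set w | Z n w <= t%:E]).
    apply: le_measure; rewrite ?inE// => w /= Yw.
    by have [n Zn] := YZ w _ _ ltr01 t1 Yw; exists n.
  move=> /le_trans/(_ PU); rewrite PY lee_fin ler_expR lerN2 divr1.
  by rewrite ler_pdivrMr// mulrC.
apply/ler_addgt0Pr => e e0.
(* For [a > 0] the choice [t = 1 + e / a] gives [b <= a + e]; for [a = 0] a single [t > 1] already
   gives [b <= 0]. *)
have [aE|a_neq0] := eqVneq a 0%R.
  by have := key 2%R (ltr1n _ 2); rewrite aE mulr0; lra.
have a_gt0 : (0 < a)%R by rewrite lt_neqAle eq_sym a_neq0.
have := key (1 + e / a)%R; rewrite ltrDl divr_gt0// => /(_ isT).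
by rewrite mulrDl mul1r -mulrA mulVf// mulr1.
Qed.

(** Truncation at [N] keeps expectations finite: a unit Frechet variable of positive scale has
    infinite mean, so scales cannot be compared through the means themselves. *)
Let exceed N (y : \bar R) : nat := (\sum_(k < N) ((k.+1%:R : R)%:E < y)%E)%N.

Let exceed_ge N m y : (m <= N)%N -> (m%:R : R)%:E < y -> (m <= exceed N y)%N.
Proof.
move=> mN my; rewrite /exceed -(subnKC mN) big_split_ord/=.
rewrite -[leqLHS]addn0 leq_add// -[leqLHS]card_ord -sum1_card.
apply: leq_sum => i _; rewrite lt0b; apply: le_lt_trans my.
by rewrite lee_fin ler_nat.
Qed.

Let exceed_le N m y : y <= (m%:R : R)%:E -> (exceed N y <= m)%N.
Proof.
move=> ym; have [Nm|mN] := leqP N m.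
  apply: leq_trans Nm; rewrite -[leqRHS]card_ord -sum1_card.
  by apply: leq_sum => i _; exact: leq_b1.
rewrite /exceed -(subnKC (ltnW mN)) big_split_ord/= [X in (_ + X)%N]big1 ?addn0.
  rewrite -[leqRHS]card_ord -sum1_card.
  by apply: leq_sum => i _; exact: leq_b1.
move=> i _; apply/eqP; rewrite eqb0 -leNgt (le_trans ym)// lee_fin ler_nat.
by rewrite -addnS leq_addr.
Qed.

(** A count below [N] bounds its argument by the count plus one, and two such roundings make the
    constant [2]. A count equal to [N] makes the right-hand side at least [N]. *)
Let exceedD N (x y z : \bar R) : z <= x + y ->
  (exceed N z <= 2 + (exceed N x + exceed N y))%N.
Proof.
move=> zxy; have exN u : (exceed N u <= N)%N.
  rewrite -[leqRHS]card_ord -sum1_card.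
  by apply: leq_sum => i _; exact: leq_b1.
have bnd u : (exceed N u < N)%N -> u <= ((exceed N u).+1%:R : R)%:E.
  move=> uN; rewrite leNgt; apply/negP => /(exceed_ge uN).
  by rewrite ltnn.
have [xN|xN] := ltnP (exceed N x) N; last first.
  by apply: leq_trans (exN z) _; rewrite addnCA (leq_trans xN)// leq_addr.
have [yN|yN] := ltnP (exceed N y) N; last first.
  by apply: leq_trans (exN z) _; rewrite addnA (leq_trans yN)// leq_addl.
apply: exceed_le; apply: (le_trans zxy); apply: le_trans (leeD (bnd _ xN) (bnd _ yN)) _.
by rewrite -EFinD lee_fin -natrD ler_nat addSn addnS.
Qed.

Let integral_sum_indic N (A : nat -> set O) : (forall k, measurable (A k)) ->
  \int[P]_w (\sum_(k < N) (\1_(A k) w : R)%:E) = \sum_(k < N) P (A k).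
Proof.
move=> mA; rewrite ge0_integral_sum//.
- by apply: eq_bigr => k _; rewrite integral_indic// setIT.
- by move=> k; apply/measurable_EFinP; exact: measurable_indic.
Qed.

Let frechet_exceed Y a k : frechet_scale P Y a ->
  measurable [set w | ((k.+1%:R : R)%:E < Y w)] /\
  P [set w | ((k.+1%:R : R)%:E < Y w)] = (1 - expR (- (a / k.+1%:R)))%:E.
Proof.
move=> [_ /(_ k.+1%:R)]; rewrite ltr0n => /(_ isT)[mY PY].
have -> : [set w | ((k.+1%:R : R)%:E < Y w)] = ~` [set w | Y w <= (k.+1%:R : R)%:E].
  by apply/seteqP; split => w /=; rewrite ltNge => /negP.
by split; [exact: measurableC|rewrite probability_setC// PY].
Qed.

(** This is the expectation of [exceedD]: the count is a sum of indicators of exceedance events,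
    whose probabilities are given by [frechet_exceed]. *)
Let sum_exp_le Y1 Y2 Z a b c N :
  (forall w, Z w <= Y1 w + Y2 w) ->
  frechet_scale P Y1 a -> frechet_scale P Y2 b -> frechet_scale P Z c ->
  (\sum_(k < N) (1 - expR (- (c / k.+1%:R))) <=
   2 + (\sum_(k < N) (1 - expR (- (a / k.+1%:R))) +
        \sum_(k < N) (1 - expR (- (b / k.+1%:R)))))%R.
Proof.
move=> ZY F1 F2 FZ.
have E1 k := frechet_exceed k F1; have E2 k := frechet_exceed k F2.
have EZ k := frechet_exceed k FZ.
pose A Y k := [set w | ((k.+1%:R : R)%:E < Y w)].
have sumE Y w : \sum_(k < N) (\1_(A Y k) w : R)%:E = ((exceed N (Y w))%:R : R)%:E.
  rewrite /exceed; elim/big_rec2: _ => [//|k x y _ ->].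
  by rewrite natrD EFinD indicE /A mem_setE.
have msum Y : (forall k, measurable (A Y k)) ->
    measurable_fun setT (fun w => \sum_(k < N) (\1_(A Y k) w : R)%:E).
  move=> mA; apply: emeasurable_sum => k.
  by apply/measurable_EFinP; exact: measurable_indic.
have sum0 Y w : 0 <= \sum_(k < N) (\1_(A Y k) w : R)%:E by rewrite sumE lee_fin.
have [m1 m2 mZ] : [/\ forall k, measurable (A Y1 k),
    forall k, measurable (A Y2 k) & forall k, measurable (A Z k)].
  by split=> k; [exact: (E1 k).1|exact: (E2 k).1|exact: (EZ k).1].
have : \int[P]_w (\sum_(k < N) (\1_(A Z k) w : R)%:E) <=
    \int[P]_w (cst 2%:E w + (\sum_(k < N) (\1_(A Y1 k) w : R)%:E +
                             \sum_(k < N) (\1_(A Y2 k) w : R)%:E)).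
  apply: ge0_le_integral => //.
  - exact (msum Z mZ).
  - apply: emeasurable_funD; first exact: measurable_cst.
    by apply: emeasurable_funD; [exact (msum Y1 m1)|exact (msum Y2 m2)].
  - move=> w _; rewrite !sumE -!EFinD lee_fin -!natrD ler_nat.
    exact: exceedD.
rewrite ge0_integralD//; last 3 first.
- by move=> w _; rewrite lee_fin.
- by move=> w _; rewrite adde_ge0.
- by apply: emeasurable_funD; [exact (msum Y1 m1)|exact (msum Y2 m2)].
rewrite ge0_integralD//; [|exact (msum Y1 m1)|exact (msum Y2 m2)].
rewrite integral_cst//.
have -> : (P : {measure set O -> \bar R}) setT = 1 by exact: probability_setT.
rewrite mule1 !integral_sum_indic//.
under eq_bigr do rewrite (EZ _).2.
under [X in _ <= _ + (X + _)]eq_bigr do rewrite (E1 _).2.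
under [X in _ <= _ + (_ + X)]eq_bigr do rewrite (E2 _).2.
by rewrite !sumEFin -!EFinD lee_fin.
Qed.

(* The number of [1 <= k <= N] below [y] is subadditive in [y] up to an
   additive constant, and its expectation for a unit Frechet variable of scale
   [a] is [a * log N] up to an additive constant. *)
Lemma frechet_scale_subadd Y1 Y2 Z a b c :
  (forall w, Z w <= Y1 w + Y2 w) ->
  frechet_scale P Y1 a -> frechet_scale P Y2 b -> frechet_scale P Z c ->
  (c <= a + b)%R.
Proof.
move=> ZY F1 F2 FZ; have [a0 b0 c0] := And3 F1.1 F2.1 FZ.1.
pose H N : R := series (@harmonic R) N.
(* Any natural number above [c] would do: [1 - expR (- x) >= x / (1 + x)] at [x = c / k] yields
   [c / (k + c) >= c / (k + m)], a shifted harmonic term. *)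
pose m := (Num.truncn c).+1.
have cm : (c <= m%:R)%R by rewrite ltW// truncnS_gt.
have upper x k : (1 - expR (- (x / k.+1%:R)) <= x * (k.+1%:R)^-1)%R.
  have := expR_ge1Dx (- (x / k.+1%:R)); move: (x / k.+1%:R)%R => y; lra.
have lower k : (c * ((m + k).+1%:R)^-1 <= 1 - expR (- (c / k.+1%:R)))%R.
  have x0 : (0 <= c / k.+1%:R)%R by rewrite divr_ge0.
  have e0 : (expR (- (c / k.+1%:R)) <= (1 + c / k.+1%:R)^-1)%R.
    by rewrite expRN lef_pV2 ?posrE ?expR_gt0 ?expR_ge1Dx// ltr_wpDr.
  have -> : (c * ((m + k).+1%:R)^-1 = c / (k.+1%:R + m%:R))%R.
    by rewrite -natrD addSn addnC.
  have k0 : (0 < k.+1%:R :> R)%R by rewrite ltr0n.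
  have : (c / (k.+1%:R + m%:R) <= c / (k.+1%:R + c))%R.
    by rewrite ler_wpM2l// lef_pV2 ?posrE ?lerD2l// ltr_pwDl// ler0n.
  have -> : (c / (k.+1%:R + c) = 1 - (1 + c / k.+1%:R)^-1)%R.
    by field; rewrite !gt_eqF//; lra.
  by lra.
have HS N : (c * (H N - H m) <= 2 + (a + b) * H N)%R.
  have hN : (H N <= H (m + N)%N)%R.
    have /nondecreasing_seqP := @nondecreasing_series R harmonic xpredT 0%N
      (fun n _ _ => ltW (harmonic_gt0 n)).
    by move=> h; apply: (nondecreasing_seqP _).1 => //; exact: leq_addl.
  have tail : (H (m + N)%N - H m = \sum_(k < N) ((m + k).+1%:R)^-1)%R.
    rewrite /H sub_series_geq ?leq_addr//.
    rewrite -[X in (\sum_(X <= _ < _) _)%R]add0n big_addn addKn big_mkord.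
    by apply: eq_bigr => k _; rewrite /= addnC.
  have -> : ((a + b) * H N = \sum_(k < N) (a * (k.+1%:R)^-1) +
      \sum_(k < N) (b * (k.+1%:R)^-1))%R.
    by rewrite -!mulr_sumr -mulrDl /H seriesEnat /= big_mkord.
  apply: (@le_trans _ _ (c * (H (m + N)%N - H m))%R).
    by rewrite ler_wpM2l//; lra.
  rewrite tail mulr_sumr.
  apply: (le_trans (ler_sum _ (fun (k : 'I_N) _ => lower k))).
  apply: (le_trans (sum_exp_le N ZY F1 F2 FZ)).
  by rewrite lerD2l; apply: lerD; apply: ler_sum => k _; exact: upper.
(* If [a + b < c], then [HS] bounds the harmonic partial sums, against their divergence. *)
rewrite leNgt; apply/negP => abc; apply: (@dvg_harmonic R).
apply: nondecreasing_is_cvgn.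
  exact: (@nondecreasing_series R harmonic xpredT 0%N
      (fun n _ _ => ltW (harmonic_gt0 n))).
exists ((2 + c * H m) / (c - (a + b)))%R => _ [N _ <-].
rewrite ler_pdivlMr; last by lra.
by have := HS N; rewrite -/(H N); lra.
Qed.

End Frechet.

(** * Topology and upper semicontinuous functions *)

Section Topology.
Context {E : ptopologicalType}.
Hypothesis hE : lchs E.
Implicit Types K C : set E.

(** The empty set fills the indices that code no member, so finite and empty families are enumerated
    too. *)
Lemma countable_range_seq T (A : set (set T)) : countable A ->
  exists g : nat -> set T, (forall n, A (g n) \/ g n = set0) /\
    forall a, A a -> exists n, g n = a.
Proof.
move=> /countable_injP[f finj].
pose g n := xget set0 [set a | A a /\ f a = n].
have gP a : A a -> A (g (f a)) /\ f (g (f a)) = f a.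
  move=> Aa; rewrite /g.
  by case: xgetP => [_ -> //|/(_ a)]; case.
exists g; split=> [n|a Aa].
  by rewrite /g; case: xgetP => [_ -> [Aa _]|_]; [left|right].
by exists (f a); have [Ag fg] := gP _ Aa; apply: finj => //; exact: mem_set.
Qed.

Lemma compact_nbhsE (x : E) : exists U, [/\ nbhs x U, compact U & closed U].
Proof.
have [lE _ _] := hE; have [U] := lE x I.
by rewrite withinET => nU [cU clU]; exists U.
Qed.

(** Finitely many interiors of compact neighbourhoods cover [K]; the closure of their union stays in
    the union of these neighbourhoods, which is compact, hence closed. *)
Lemma compact_precompact_open K : compact K ->
  exists W, [/\ open W, K `<=` W & compact (closure W)].
Proof.
move=> cK; pose U x := projT1 (cid (compact_nbhsE x)).
have UP x : [/\ nbhs x (U x), compact (U x) & closed (U x)].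
  exact: projT2 (cid (compact_nbhsE x)).
have [] : finite_subset_cover K (fun x => (U x)°) K.
  move: (cK); rewrite compact_cover; apply.
  - by move=> x _; exact: open_interior.
  - by move=> x Kx; exists x => //; have [] := UP x.
move=> D' D'K KD'.
exists (\bigcup_(x in [set` D']) (U x)°); split => //.
  by apply: bigcup_open => x _; exact: open_interior.
have cU : compact (\bigcup_(x in [set` D']) U x).
  by rewrite bigcup_fset; apply: bigsetU_compact => x _; have [] := UP x.
have [_ hausE _] := hE.
apply: (subclosed_compact _ cU); first exact: closed_closure.
rewrite [X in _ `<=` X](closure_id _).1; last exact: compact_closed.
apply: closureS => y [x D'x Uy].
by exists x => //; exact: interior_subset.
Qed.

(** From a relatively compact open [W] the closures of those basis members whose closure misses [K]
    are removed one after the other. By regularity each point outside [K] lies in such a member, so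
    it leaves the closures at some stage. *)
Lemma compact_open_enlargement K : compact K ->
  exists V : nat -> set E,
    [/\ (forall n, open (V n)), (forall n, K `<=` V n),
        (forall n, compact (closure (V n))),
        (forall n, V n.+1 `<=` V n) & \bigcap_n closure (V n) = K].
Proof.
move=> cK; have [_ hausE [B cB [oB nB]]] := hE.
have [W [oW KW cW]] := compact_precompact_open cK.
have clK : closed K by exact: compact_closed.
pose B' := [set b | B b /\ closure b `&` K = set0].
have cB' : countable B'.
  by apply: sub_countable cB; apply: subset_card_le => b [].
have [g [gP gB']] := countable_range_seq cB'.
have og n : open (g n).
  by have [[/oB]|->] := gP n => //; exact: open0.
have gK n : closure (g n) `&` K = set0.
  by have [[]|->] := gP n => //; rewrite closure0 set0I.
pose V := fix V n := if n is m.+1 then V m `&` ~` closure (g m) else W.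
have Vdec n : V n.+1 `<=` V n by move=> x [].
have VW n : V n `<=` W by elim: n => // n ih x /Vdec/ih.
have KV n : K `<=` V n.
  elim: n => // n ih x Kx; split; first exact: ih.
  by move=> gx; have := gK n; apply/eqP/set0P; exists x.
exists V; split => //.
- elim=> // n ih; apply: openI => //.
  by apply: closed_openC; exact: closed_closure.
- move=> n; apply: (subclosed_compact _ cW); first exact: closed_closure.
  exact: closureS.
- apply/seteqP; split=> [x Vx|x Kx n _]; last by apply: subset_closure; exact: KV.
  apply: contrapT => nKx.
  have [U [nU cU _]] := compact_nbhsE x.
  have nKC : nbhs x (~` K).
    by apply: open_nbhs_nbhs; split => //; exact: closed_openC.
  have [i nxi iK] := compact_regular hausE cU nU nKC.
  have [b [Bb bx] bi] := nB x i nxi.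
  have [n gn] : exists n, g n = b.
    apply: gB'; split => //; rewrite -subset0 => y [cby Ky].
    by apply: (iK y) => //; exact: closureS cby.
  suff : closure (V n.+1) `<=` ~` b by apply; [exact: Vx|].
  rewrite [X in _ `<=` X](closure_id _).1; last first.
    by apply: open_closedC; exact: oB.
  by apply: closureS => y [_]; apply: contra_not => ?; rewrite gn; exact: subset_closure.
Qed.

End Topology.

(** * Upper semicontinuous functions and their step approximations *)

Section UpperSemicontinuous.
Context {R : realType} {E : ptopologicalType}.
Implicit Types (f g : E -> R) (K : set E).

Lemma USC0 : USC (fun=> 0 : R) (E := E).
Proof.
split=> //; first by exists 0.
- move=> t; have [t0|t0] := ltP 0 t.
    by rewrite (_ : mkset _ = setT)//; [exact: openT|exact/seteqP].
  rewrite (_ : mkset _ = set0); first exact: open0.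
  by apply/seteqP; split => x //=; rewrite ltNge t0.
- rewrite (_ : mkset _ = set0); last by apply/seteqP; split => x //=; rewrite eqxx.
  by rewrite precompactE closure0; exact: compact0.
Qed.

Lemma USC_add f g : USC f -> USC g -> USC (fun x => f x + g x).
Proof.
move=> [f0 [M fM] fo fc] [g0 [N gN] go gc]; split.
- by move=> x; rewrite addr_ge0.
- by exists (M + N) => x; rewrite lerD.
- move=> t; rewrite (_ : mkset _ =
      \bigcup_a ([set x | f x < a] `&` [set x | g x < t - a])).
    by apply: bigcup_open => a _; apply: openI.
  apply/seteqP; split=> [x /= fg|x [a _ [/= fa ga]]]; last by lra.
  (* Half of the gap between [f x + g x] and [t] is given to each summand. *)
  exists (f x + (t - (f x + g x)) / 2) => //; split => /=; lra.
- have : precompact ([set x | f x != 0] `|` [set x | g x != 0]).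
    by rewrite precompactE closureU; apply: compactU; rewrite -precompactE.
  apply: precompact_subset => x /= fg.
  have [fx0|?] := eqVneq (f x) 0; last by left.
  by right; move: fg; rewrite fx0 add0r.
Qed.

Lemma USC_scale (c : R) f : 0 < c -> USC f -> USC (fun x => c * f x).
Proof.
move=> c0 [f0 [M fM] fo fc]; split.
- by move=> x; rewrite mulr_ge0// ltW.
- by exists (c * M) => x; rewrite ler_wpM2l// ltW.
- move=> t; rewrite (_ : mkset _ = [set x | f x < t / c])//.
  by apply/seteqP; split => x /=; rewrite ltr_pdivlMr// mulrC.
- by apply: precompact_subset fc => x /=; apply: contraNneq => ->; rewrite mulr0.
Qed.

Lemma USC_indic K : closed K -> compact K -> USC (\1_K : E -> R).
Proof.
move=> clK cK; split.
- by move=> x; rewrite indicE.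
- by exists 1 => x; rewrite indicE lern1 leq_b1.
- move=> t; have [t0|t0] := leP t 0.
    rewrite (_ : mkset _ = set0); first exact: open0.
    by apply/seteqP; split => x //=; rewrite ltNge indicE (le_trans t0).
  have [t1|t1] := leP t 1.
    rewrite (_ : mkset _ = ~` K); first exact: closed_openC.
    apply/seteqP; split => x /=; rewrite indicE.
      by move=> + Kx; rewrite mem_set// ltNge t1.
    by move=> Kx; rewrite memNset.
  rewrite (_ : mkset _ = setT)//; first exact: openT.
  apply/seteqP; split => x //= _; apply: le_lt_trans t1.
  by rewrite indicE lern1 leq_b1.
- apply: (@precompact_subset _ _ K); last by rewrite precompact_closed.
  by move=> x /=; rewrite indicE; case: (boolP (x \in K)) => [/set_mem//|_]; rewrite eqxx.
Qed.

(** A layer sum: for decreasing [A] and [d > 0], the superlevel set at height [(k + 1) * d] with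
    [k < n] is [A k]. *)
Definition step (d : R) (A : nat -> set E) (n : nat) (x : E) : R :=
  \sum_(k < n) d * \1_(A k) x.

Lemma stepS d A n x : step d A n.+1 x = step d A n x + d * \1_(A n) x.
Proof. by rewrite /step big_ord_recr. Qed.

Lemma step_le d A n x : 0 <= d -> step d A n x <= n%:R * d.
Proof.
move=> d0; elim: n => [|n ih]; first by rewrite /step big_ord0 mul0r.
rewrite stepS -natr1 mulrDl mul1r lerD//.
by rewrite ler_piMr// indicE lern1 leq_b1.
Qed.

Lemma step_ge0 d A n x : 0 <= d -> 0 <= step d A n x.
Proof. by move=> d0; apply: sumr_ge0 => k _; rewrite mulr_ge0// indicE. Qed.

(** Take the last layer [k] containing [x]: only the layers [0] to [k] can contribute. *)
Lemma step_le_level d A n x : 0 <= d -> step d A n x = 0 \/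
  exists k, [/\ (k < n)%N, A k x & step d A n x <= k.+1%:R * d].
Proof.
move=> d0; elim: n => [|n ih]; first by left; rewrite /step big_ord0.
have [Ax|nAx] := pselect (A n x).
  by right; exists n; split => //; exact: step_le.
rewrite stepS indicE memNset// mulr0 addr0.
case: ih => [->|[k [kn Ak kle]]]; [by left|right].
by exists k; split => //; exact: ltnW.
Qed.

Lemma step_level_le d A n x k : 0 <= d -> (forall k, A k.+1 `<=` A k) ->
  (k < n)%N -> A k x -> k.+1%:R * d <= step d A n x.
Proof.
move=> d0 Adec; elim: n k => // n ih k; rewrite stepS ltnS => kn Ak.
have dn : 0 <= d * \1_(A n) x by rewrite mulr_ge0// indicE.
have [kn'|nk] := ltnP k n.
  by apply: le_trans (ih _ kn' Ak) _; rewrite lerDl.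
have kE : k = n by apply/eqP; rewrite eqn_leq kn.
rewrite -kE indicE mem_set// mulr1 -natr1 mulrDl mul1r lerD2r kE.
case: n => [|n] in ih kn nk kE dn Ak *; first by rewrite mul0r step_ge0.
by apply: ih => //; apply: Adec; rewrite -kE.
Qed.

Lemma USC_step d A n : 0 < d -> (forall k, closed (A k)) ->
  (forall k, compact (A k)) -> USC (step d A n).
Proof.
move=> d0 clA cA; elim: n => [|n ih].
  rewrite (_ : step d A 0 = fun=> 0); first exact: USC0.
  by apply/funext => x; rewrite /step big_ord0.
rewrite (_ : step d A n.+1 = fun x => step d A n x + d * \1_(A n) x).
  by apply: USC_add => //; apply: USC_scale => //; exact: USC_indic.
by apply/funext => x; exact: stepS.
Qed.

(* The step function of the superlevel sets of [f] is [d * floor (f / d)],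
   truncated at [n * d]. *)
Lemma step_superlevel_le d f n x : 0 <= d -> 0 <= f x ->
  step d (fun k => [set x | k.+1%:R * d <= f x]) n x <= f x.
Proof.
move=> d0 fx; have [->//|[k [_ kf]]] := step_le_level (fun k => [set x | k.+1%:R * d <= f x]) n x d0.
by move=> /le_trans; apply.
Qed.

(** The bound on [f x] makes the truncation harmless, so only the rounding error [d] remains. *)
Lemma step_superlevel_ge d f n x : 0 < d -> f x <= n%:R * d ->
  f x <= step d (fun k => [set x | k.+1%:R * d <= f x]) n x + d.
Proof.
move=> d0; elim: n => [|n ih] fn.
  by move: fn; rewrite mul0r /step big_ord0 add0r => /le_trans; apply; exact: ltW.
rewrite stepS; have [fn'|/ltW nf] := leP (f x) (n%:R * d).
  apply: le_trans (ih fn') _; rewrite lerD2r lerDl mulr_ge0// ?ltW// indicE.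
have d0' := ltW d0.
have step_n : n%:R * d <= step d (fun k => [set x | k.+1%:R * d <= f x]) n x.
  case: n => [|n] in ih fn nf *; first by rewrite mul0r step_ge0.
  apply: (@step_level_le d _ n.+1 x n) => // k y /=; apply: le_trans.
  by rewrite ler_wpM2r// ler_nat.
apply: le_trans fn _; rewrite -natr1 mulrDl mul1r lerD2r.
by apply: le_trans step_n _; rewrite lerDl mulr_ge0// indicE.
Qed.

Lemma USC_superlevel f t : USC f -> hausdorff_space E -> 0 < t ->
  closed [set x | t <= f x] /\ compact [set x | t <= f x].
Proof.
move=> [f0 _ fo fc] hausE t0.
have cl : closed [set x | t <= f x].
  rewrite (_ : mkset _ = ~` [set x | f x < t]); first exact: open_closedC.
  by apply/seteqP; split => x /=; rewrite leNgt => /negP H; [exact: H|exact: H].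
split => //; rewrite -precompact_closed//.
by apply: precompact_subset fc => x /= tf; rewrite gt_eqF// (lt_le_trans t0).
Qed.

End UpperSemicontinuous.

(** * Sup-measures and extremal integrals *)

Section SupMeasure.
Context {R : realType} {E : ptopologicalType}.
Hypothesis hE : lchs E.
Variable phi : set E -> \bar R.
Hypothesis hphi : sup_measure phi.
Implicit Types (f g : E -> R) (K : set E).
Local Open Scope ereal_scope.

Let phi_mono A B : A `<=` B -> phi A <= phi B.
Proof. by have [[h _] _ _ _ _] := hphi; exact: h. Qed.

Let phi0 : phi set0 = 0.
Proof. by have [[_ h] _ _ _ _] := hphi; exact: h. Qed.

Lemma sup_measure_ge0 A : 0 <= phi A.
Proof. by rewrite -phi0; exact: phi_mono. Qed.

Lemma sup_measure_bigcap_lt (K : nat -> set E) t : (forall n, compact (K n)) ->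
  (forall n, K n.+1 `<=` K n) -> phi (\bigcap_n K n) < t ->
  exists n, phi (K n) < t.
Proof.
move=> cK Kdec phit; have [_ _ h _ _] := hphi.
have := h _ cK Kdec => cvgK.
apply: contrapT => /forallNP nt; move: phit; apply/negP; rewrite -leNgt.
rewrite -(cvg_lim _ cvgK)//; apply: lime_ge.
  by apply/cvg_ex; eexists; exact: cvgK.
by apply: nearW => n; rewrite leNgt; apply/negP.
Qed.

(** By outer continuity each point of [K] has an open neighbourhood of value at most [s + e], and by
    maxitivity the union of all such open sets, which contains [K], still has value at most
    [s + e]. *)
Lemma sup_measure_le_points K s : 0 <= s ->
  (forall x, K x -> phi [set x] <= s) -> phi K <= s.
Proof.
move=> s0 Ks; have [->|s_fin] := eqVneq s +oo; first exact: leey.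
apply/lee_addgt0Pr => e e0.
have se : s < s + e%:E.
  by rewrite lteDl ?lte_fin// ge0_fin_numE// ltey.
pose G := [set U | open U /\ phi U <= s + e%:E].
have GU : phi (\bigcup_(U in G) U) <= s + e%:E.
  have [_ _ _ _ ->] := hphi.
  - by apply: ge_ereal_sup => _ [U [_ Us] <-].
  - by exists set0; split; [exact: open0|rewrite phi0 adde_ge0// lee_fin ltW].
  - by move=> U [].
apply: le_trans GU; apply: phi_mono => x Kx.
have [V [oV xV cV Vdec capV]] := compact_open_enlargement hE (@compact_set1 _ x).
have [n phin] : exists n, phi (closure (V n)) < s + e%:E.
  apply: sup_measure_bigcap_lt => //; first by move=> n; apply: closureS.
  by rewrite capV; apply: le_lt_trans se; exact: Ks.
exists (V n); last exact: xV.
split=> //; apply: le_trans (ltW phin); apply: phi_mono.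
exact: subset_closure.
Qed.

(** If [f] has infimum [i > 0] on [K] and [s] is the supremum over points, then each point of [K]
    has value at most [s / i], hence so does [K] by [sup_measure_le_points]. *)
Lemma ext_integralE f : (forall x, (0 <= f x)%R) ->
  ext_integral f phi = ereal_sup [set phi [set x] * (f x)%:E | x in setT].
Proof.
move=> f0; apply/eqP; rewrite eq_le; apply/andP; split; last first.
  apply: ge_ereal_sup => _ [x _ <-]; apply: ereal_sup_ubound.
  exists [set x]; first exact: compact_set1.
  by congr (_ * _); rewrite image_set1 ereal_inf1.
set s := ereal_sup _.
have phif x : phi [set x] * (f x)%:E <= s by apply: ereal_sup_ubound; exists x.
have s0 : 0 <= s.
  by apply: le_trans (phif point); rewrite mule_ge0 ?sup_measure_ge0 ?lee_fin.
apply: ge_ereal_sup => _ [K cK <-].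
have [->|/set0P[x0 Kx0]] := eqVneq K set0; first by rewrite phi0 mul0e.
have i0 : 0 <= ereal_inf [set (f x)%:E | x in K].
  by apply: le_ereal_inf_tmp => _ [x Kx <-]; rewrite lee_fin.
have iK x : K x -> ereal_inf [set (f x)%:E | x in K] <= (f x)%:E.
  by move=> Kx; apply: ereal_inf_lbound; exists x.
(* An infinite infimum is excluded by the point [x0] of [K]. *)
move: i0 iK; case: (ereal_inf _) => [i| |] //; last first.
  by move=> _ /(_ _ Kx0); rewrite leye_eq.
move=> + iK; rewrite lee_fin le0r => /orP[/eqP->|i0]; first by rewrite mule0.
rewrite muleC -lee_pdivlMl//; apply: sup_measure_le_points.
  by rewrite mule_ge0// lee_fin invr_ge0 ltW.
move=> x Kx; rewrite lee_pdivlMl// muleC; apply: le_trans (phif x).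
by rewrite lee_wpmul2l ?sup_measure_ge0// iK.
Qed.

Lemma ext_integral_le f g : (forall x, (f x <= g x)%R) ->
  ext_integral f phi <= ext_integral g phi.
Proof.
move=> fg; apply: ge_ereal_sup => _ [K cK <-].
apply: le_ereal_sup_tmp; exists (phi K * ereal_inf [set (g x)%:E | x in K]).
  by exists K.
rewrite lee_wpmul2l ?sup_measure_ge0//.
apply: le_ereal_inf_tmp => _ [x Kx <-].
by apply: (@le_trans _ _ (f x)%:E); [apply: ereal_inf_lbound; exists x|rewrite lee_fin].
Qed.

Lemma ext_integral_add f g :
  (forall x, (0 <= f x)%R) -> (forall x, (0 <= g x)%R) ->
  ext_integral (fun x => f x + g x)%R phi <= ext_integral f phi + ext_integral g phi.
Proof.
move=> f0 g0; rewrite !ext_integralE//; last by move=> x; rewrite addr_ge0.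
apply: ge_ereal_sup => _ [x _ <-]; rewrite EFinD ge0_muleDr ?lee_fin//.
by apply: leeD; apply: ereal_sup_ubound; exists x.
Qed.

Lemma ext_integral_scale (c : R) f : (0 < c)%R -> (forall x, (0 <= f x)%R) ->
  ext_integral (fun x => c * f x)%R phi <= c%:E * ext_integral f phi.
Proof.
move=> c0 f0; rewrite !ext_integralE//; last by move=> x; rewrite mulr_ge0// ltW.
apply: ge_ereal_sup => _ [x _ <-].
rewrite EFinM muleCA lee_pmul2l ?lte_fin//.
by apply: ereal_sup_ubound; exists x.
Qed.

(** On [K k] the step function is at least [(k + 1) * d], so [phi (K k)] is controlled by [s]. Outer
    continuity gives an index for each of the [n] layers, and the largest one serves all. The
    enlarged layers need not be nested in [k], so the value at [x] is bounded through the last layer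
    containing it. *)
Lemma ext_integral_step_enlarge (K : nat -> set E) (C : nat -> nat -> set E)
    (d s t : R) n :
  (0 < d)%R -> (forall k, compact (K k)) -> (forall k, K k.+1 `<=` K k) ->
  (forall k j, compact (C k j)) -> (forall k j, C k j.+1 `<=` C k j) ->
  (forall k, \bigcap_j C k j = K k) -> (0 < s < t)%R ->
  ext_integral (step d K n) phi <= s%:E ->
  exists j, ext_integral (step d (C ^~ j) n) phi <= t%:E.
Proof.
move=> d0 cK Kdec cC Cdec capC /andP[s0 st] Is.
have kd k : (0 < k.+1%:R * d)%R by rewrite mulr_gt0// ltr0n.
have phiK k : (k < n)%N -> (k.+1%:R * d)%:E * phi (K k) <= s%:E.
  move=> kn; rewrite muleC; apply: le_trans Is.
  apply: le_ereal_sup_tmp.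
  exists (phi (K k) * ereal_inf [set (step d K n x)%:E | x in K k]).
    by exists (K k).
  rewrite lee_wpmul2l ?sup_measure_ge0//.
  apply: le_ereal_inf_tmp => _ [x Kx <-]; rewrite lee_fin.
  by apply: step_level_le => //; exact: ltW.
have level k : exists j, (k < n)%N -> (k.+1%:R * d)%:E * phi (C k j) <= t%:E.
  have [kn|nk] := ltnP k n; last by exists 0%N.
  have [|j phij] := @sup_measure_bigcap_lt (C k) ((k.+1%:R * d)^-1%:E * t%:E) (cC k) (Cdec k).
    rewrite capC lte_pdivlMl//; apply: le_lt_trans (phiK _ kn) _.
    by rewrite lte_fin.
  by exists j => _; rewrite -lee_pdivlMl// ltW.
have [J JP] := choice level.
exists (\max_(k < n) J k)%N; set j := (\max_(k < n) J k)%N.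
rewrite ext_integralE; last by move=> x; apply: step_ge0; exact: ltW.
apply: ge_ereal_sup => _ [x _ <-].
have [->|[k [kn Cx gk]]] := step_le_level (C ^~ j) n x (ltW d0).
  by rewrite mule0 lee_fin (le_trans (ltW s0))// ltW.
have CJ : C k j `<=` C k (J k).
  have Jj : (J k <= j)%N by exact: (leq_bigmax (Ordinal kn)).
  rewrite -(subnK Jj); elim: (j - J k)%N => [//|m ih].
  by rewrite addSn; apply: subset_trans ih; exact: Cdec.
apply: le_trans (JP _ kn); rewrite muleC.
apply: lee_pmul; rewrite ?lee_fin ?step_ge0 ?(ltW d0) ?sup_measure_ge0//.
by apply: phi_mono => _ ->; exact: CJ.
Qed.

End SupMeasure.

(** * Radon measures from contents *)

Section ContentMeasure.
Context {R : realType} {E : ptopologicalType}.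
Hypothesis hE : lchs E.
Implicit Types (K G U A : set E).

Lemma compact_nbhs_sub x U : open U -> U x ->
  exists N, [/\ nbhs x N, compact N & N `<=` U].
Proof.
move=> oU Ux; have [_ hausE _] := hE.
have [W [nW cW _]] := compact_nbhsE hE x.
have nWU : nbhs x (W `&` U) by apply: filterI => //; exact: open_nbhs_nbhs.
have [N nN NWU] := compact_regular hausE cW nW nWU.
exists (closure N); split; last by move=> y /NWU[].
  by apply: filterS nN; exact: subset_closure.
by apply: (subclosed_compact _ cW); [exact: closed_closure|move=> y /NWU[]].
Qed.

(** Each point of [K] has a compact neighbourhood inside some [G i]; finitely many of them cover
    [K], and [L i] collects those assigned to the index [i]. *)
Lemma compact_bigcup_split K (G : nat -> set E) : compact K ->
  (forall i, open (G i)) -> K `<=` \bigcup_i G i ->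
  exists n (L : nat -> set E), [/\ (forall i, compact (L i)),
    (forall i, L i `<=` G i) & K `<=` \big[setU/set0]_(i < n) L i].
Proof.
move=> cK oG KG.
have nb x : exists p : nat * set E,
    K x -> [/\ nbhs x p.2, compact p.2 & p.2 `<=` G p.1].
  have [Kx|nKx] := pselect (K x); last by exists (0%N, set0).
  have [i _ Gx] := KG x Kx; have [N NP] := compact_nbhs_sub (oG i) Gx.
  by exists (i, N).
have [p pP] := choice nb.
have [] : finite_subset_cover K (fun x => (p x).2°) K.
  move: (cK); rewrite compact_cover; apply.
  - by move=> x _; exact: open_interior.
  - by move=> x Kx; exists x => //; have [] := pP x Kx.
move=> D' D'K KD'.
pose L i := \big[setU/set0]_(x <- D' | (x \in D') && ((p x).1 == i)) (p x).2.
have inK x : x \in D' -> K x by move=> /D'K/set_mem.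
exists (\max_(x <- D') (p x).1).+1, L; split => [i|i|y Ky].
- by apply: bigsetU_compact => x /andP[/inK Kx _]; have [] := pP x Kx.
- apply: (big_ind (fun A => A `<=` G i)) => //; first by move=> A B; rewrite subUset; split.
  by move=> x /andP[/inK Kx /eqP<-]; have [] := pP x Kx.
- have [x /= xD' /interior_subset Ny] := KD' y Ky.
  have pn : ((p x).1 < (\max_(x <- D') (p x).1).+1)%N.
    by rewrite ltnS; apply: leq_bigmax_seq.
  rewrite -bigcup_mkord; exists (p x).1 => //=.
  by rewrite /L -big_filter -bigcup_seq; exists x => //=; rewrite mem_filter xD' eqxx.
Qed.

Variable m : set E -> R.
Hypothesis m_ge0 : forall K, compact K -> 0 <= m K.
Hypothesis m_mono : forall K L, compact K -> compact L -> K `<=` L -> m K <= m L.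
Hypothesis m_subU : forall K L, compact K -> compact L ->
  m (K `|` L) <= m K + m L.
Hypothesis m_addU : forall K L, compact K -> compact L -> K `&` L = set0 ->
  m K + m L <= m (K `|` L).
Local Open Scope ereal_scope.

(** The classical two-stage extension of a content: inner approximation by compacts, used on open
    sets, then outer approximation by open sets. *)
Let inner G := ereal_sup [set (m K)%:E | K in [set K | compact K /\ K `<=` G]].
Let outer A := ereal_inf [set inner G | G in [set G | open G /\ A `<=` G]].

Let m0 : (m set0 = 0)%R.
Proof.
have := m_addU (@compact0 _) (@compact0 _) (setI0 _); rewrite setU0.
by have := m_ge0 (@compact0 _); lra.
Qed.

Let inner_ub K G : compact K -> K `<=` G -> (m K)%:E <= inner G.
Proof. by move=> cK KG; apply: ereal_sup_ubound; exists K. Qed.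

Let inner_mono G U : G `<=` U -> inner G <= inner U.
Proof.
move=> GU; apply: ereal_sup_le => _ [K [cK KG] <-].
by exists K => //; split => //; exact: subset_trans GU.
Qed.

Let inner_ge0 G : 0 <= inner G.
Proof.
have := @inner_ub set0 G (@compact0 _) (@sub0set _ _).
by apply: le_trans; rewrite m0.
Qed.

Let inner_le G s : (forall K, compact K -> K `<=` G -> (m K)%:E <= s) -> inner G <= s.
Proof. by move=> h; apply: ge_ereal_sup => _ [K [cK KG] <-]; exact: h. Qed.

Let m_bigsetU n (L : nat -> set E) : (forall i, compact (L i)) ->
  (m (\big[setU/set0]_(i < n) L i) <= \sum_(i < n) m (L i))%R.
Proof.
move=> cL; elim: n => [|n ih]; first by rewrite !big_ord0 m0.
rewrite !big_ord_recr /=; apply: le_trans (m_subU _ (cL n)) _.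
  by apply: bigsetU_compact => i _; exact: cL.
by rewrite lerD2r.
Qed.

Let inner_sigma_subadditive (G : nat -> set E) : (forall i, open (G i)) ->
  inner (\bigcup_i G i) <= \sum_(i <oo) inner (G i).
Proof.
move=> oG; apply: inner_le => K cK KG.
have [n [L [cL LG KL]]] := compact_bigcup_split cK oG KG.
apply: (@le_trans _ _ (\sum_(0 <= i < n) inner (G i))); last first.
  by apply: nneseries_lim_ge => i _ _; exact: inner_ge0.
rewrite big_mkord; apply: (@le_trans _ _ (\sum_(i < n) m (L i))%:E).
  rewrite lee_fin; apply: le_trans (m_bigsetU n cL).
  by apply: m_mono => //; apply: bigsetU_compact => i _; exact: cL.
by rewrite -sumEFin; apply: lee_sum => i _; exact: inner_ub.
Qed.

Let outer_le A G : open G -> A `<=` G -> outer A <= inner G.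
Proof. by move=> oG AG; apply: ereal_inf_lbound; exists G. Qed.

Let outer_ge A s : (forall G, open G -> A `<=` G -> s <= inner G) -> s <= outer A.
Proof. by move=> h; apply: le_ereal_inf_tmp => _ [G [oG AG] <-]; exact: h. Qed.

Let outer0 : outer set0 = 0.
Proof.
apply/eqP; rewrite eq_le; apply/andP; split; last first.
  by apply: outer_ge => G _ _; exact: inner_ge0.
apply: (le_trans (outer_le open0 (@subset_refl _ _))).
by apply: inner_le => K _; rewrite subset0 => ->; rewrite m0.
Qed.

Let outer_ge0 A : 0 <= outer A.
Proof. by apply: outer_ge => G _ _; exact: inner_ge0. Qed.

Let outer_mono : {homo outer : A B / A `<=` B >-> A <= B}.
Proof.
move=> A B AB; apply: outer_ge => G oG BG; apply: outer_le => //.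
exact: subset_trans BG.
Qed.

Let outer_sigma_subadditive : sigma_subadditive outer.
Proof.
move=> F; apply/lee_addgt0Pr => e e0.
have near_inf i : exists G, [/\ open G, F i `<=` G &
    inner G <= outer (F i) + (e / (2 ^ i.+1)%:R)%:E].
  have ei : (0 < e / (2 ^ i.+1)%:R)%R by rewrite divr_gt0// ltr0n expn_gt0.
  (* Where [outer (F i)] is infinite, the whole space serves as the open superset. *)
  have [Ffin|] := boolP (outer (F i) \is a fin_num); last first.
    rewrite ge0_fin_numE// -leNgt leye_eq => /eqP->.
    by exists setT; split => //; [exact: openT|rewrite leey].
  have /ereal_inf_lt[_ [G [oG FG] <-] GF] :
      outer (F i) < outer (F i) + (e / (2 ^ i.+1)%:R)%:E by rewrite lteDl.
  by exists G; split => //; exact: ltW.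
have [G GP] := choice near_inf.
apply: (@le_trans _ _ (inner (\bigcup_i G i))).
  apply: outer_le; first by apply: bigcup_open => i _; have [] := GP i.
  by move=> x [i _ Fx]; exists i => //; have [_ + _] := GP i; exact.
apply: le_trans (inner_sigma_subadditive _) _.
  by move=> i; have [] := GP i.
apply: le_trans (epsilon_trick xpredT (fun i => outer_ge0 (F i)) (ltW e0)).
by apply: lee_nneseries => i _ //; have [] := GP i.
Qed.

(** For open [G] containing [X], compact [K] in [G] and [A], and compact [L] in [G] off [K],
    additivity on disjoint compacts gives [m K + m L <= inner G]. The supremum over [L] dominates
    [outer] of the part of [X] outside [A]; then the supremum over [K] is taken. *)
Let outer_caratheodory A : open A -> caratheodory_measurable outer A.
Proof.
pose mu : {outer_measure set E -> \bar R} := HB.pack outer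
  (isOuterMeasure.Build R E outer outer0 outer_ge0 outer_mono outer_sigma_subadditive).
move=> oA; apply: (@le_caratheodory_measurable _ _ mu) => X /=.
apply: outer_ge => G oG XG.
have [_ hausE _] := hE.
have key K : compact K -> K `<=` G `&` A ->
    (m K)%:E + outer (X `&` ~` A) <= inner G.
  move=> cK KGA; have clK : closed K by exact: compact_closed.
  apply: (@le_trans _ _ ((m K)%:E + inner (G `&` ~` K))).
    rewrite leeD2l//; apply: outer_le.
      by apply: openI => //; exact: closed_openC.
    move=> x [Xx nAx]; split; first exact: XG.
    by apply: contra_not nAx => /KGA[].
  rewrite addeC -leeBrDr//; apply: inner_le => L cL LGK.
  rewrite leeBrDr// addeC -EFinD; apply: (@le_trans _ _ (m (K `|` L))%:E).
    rewrite lee_fin; apply: m_addU => //; rewrite -subset0 => x [Kx /LGK[_]].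
    exact.
  apply: inner_ub; first exact: compactU.
  by rewrite subUset; split => x; [move=> /KGA[]|move=> /LGK[]].
apply: (@le_trans _ _ (inner (G `&` A) + outer (X `&` ~` A))).
  rewrite leeD2r//; apply: outer_le; first exact: openI.
  by apply: setSI.
(* Subtraction needs a finite value; in the infinite case [key] for the empty compact shows that
   [inner G] is infinite. *)
have := outer_ge0 (X `&` ~` A); move: (outer _) key => [r| |] key //= _.
  rewrite -leeBrDr//; apply: inner_le => K cK KGA.
  by rewrite leeBrDr//; exact: key.
have := key set0 (@compact0 _) (@sub0set _ _).
by rewrite addey// leye_eq => /eqP->; rewrite leey.
Qed.

(** The content is not assumed regular, so [mu K] may exceed [m K]; the upper bound is therefore
    stated for open sets inside a compact. *)
Lemma content_measure : exists mu : {measure set (borelE E) -> \bar R},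
  (forall K, compact K -> (m K)%:E <= mu K) /\
  (forall G K, open G -> compact K -> G `<=` K -> mu G <= (m K)%:E).
Proof.
pose mu : {outer_measure set E -> \bar R} := HB.pack outer
  (isOuterMeasure.Build R E outer outer0 outer_ge0 outer_mono outer_sigma_subadditive).
have sub (A : set (borelE E)) : measurable A -> caratheodory_measurable mu A.
  apply: smallest_sub; last by move=> B; exact: outer_caratheodory.
  exact: (sigma_algebra_measurable (caratheodory_type mu)).
have mu_add : semi_sigma_additive (outer : set (borelE E) -> \bar R).
  move=> A mA tA mUA; apply: (@caratheodory_measure_sigma_additive R E mu) => //.
  - by move=> i; exact: sub.
  - exact: sub.
pose nu : {measure set (borelE E) -> \bar R} :=
  HB.pack (outer : set (borelE E) -> \bar R)
    (isMeasure.Build _ (borelE E) R outer outer0 outer_ge0 mu_add).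
exists nu; split=> [K cK|G K oG cK GK] /=.
  by apply: outer_ge => G oG KG; exact: inner_ub.
apply: le_trans (outer_le oG (@subset_refl _ _)) _.
have [_ hausE _] := hE.
by apply: inner_le => L cL LG; rewrite lee_fin m_mono//; exact: subset_trans GK.
Qed.

End ContentMeasure.

(** * Representation of sublinear functionals on USC *)

Section BorelIntegrals.
Context {R : realType} {E : ptopologicalType}.
Implicit Types (f : E -> R) (mu : {measure set (borelE E) -> \bar R}).
Local Open Scope ereal_scope.

Lemma open_measurable_borelE (U : set E) :
  open U -> measurable (U : set (borelE E)).
Proof. by move=> oU; exact: sub_sigma_algebra. Qed.

Lemma closed_measurable_borelE (C : set E) :
  closed C -> measurable (C : set (borelE E)).
Proof.
move=> cC; rewrite -(setCK C); apply: measurableC.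
by apply: open_measurable_borelE; exact: closed_openC.
Qed.

Lemma USC_measurable f : USC f ->
  measurable_fun setT (fun x : borelE E => (f x)%:E).
Proof.
move=> [_ _ fo _]; apply/measurable_EFinP.
apply: (measurability _ (RGenInftyO.measurableE R)) => //.
move=> _ [_ [t ->] <-]; rewrite setTI.
rewrite (_ : _ @^-1` _ = [set x | (f x < t)%R]); first exact: open_measurable_borelE.
by apply/seteqP; split => x /=; rewrite in_itv.
Qed.

Lemma integral_step mu (d : R) (A : nat -> set E) n : (0 <= d)%R ->
  (forall k, closed (A k)) ->
  \int[mu]_x (step d A n x)%:E = \sum_(k < n) d%:E * mu (A k).
Proof.
move=> d0 clA; have mA k := closed_measurable_borelE (clA k).
have mI k : measurable_fun setT (fun x : borelE E => (\1_(A k) x : R)%:E).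
  by apply/measurable_EFinP; exact: measurable_indic.
under eq_integral do rewrite /step -sumEFin.
rewrite ge0_integral_sum//; first last.
- by move=> k x _; rewrite lee_fin mulr_ge0// indicE.
- by move=> k; under eq_fun do rewrite EFinM; exact: measurable_funeM.
apply: eq_bigr => k _; under eq_integral do rewrite EFinM.
by rewrite ge0_integralZl// integral_indic// setIT.
Qed.

Lemma integral_convex (mu nu rho : {measure set (borelE E) -> \bar R}) (a : R) f :
  (0 <= a <= 1)%R -> USC f ->
  (forall A, measurable A -> rho A = a%:E * mu A + (1 - a)%:E * nu A) ->
  \int[rho]_x (f x)%:E =
    a%:E * \int[mu]_x (f x)%:E + (1 - a)%:E * \int[nu]_x (f x)%:E.
Proof.
move=> /andP[a0 a1] uf rhoE; have mf := USC_measurable uf.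
have f0 (x : borelE E) : [set: borelE E] x -> 0 <= (f x)%:E.
  by move=> _; rewrite lee_fin; have [] := uf.
have b0 : (0 <= 1 - a)%R by rewrite subr_ge0.
transitivity (\int[measure_add (mscale (NngNum a0) mu)
    (mscale (NngNum b0) nu)]_x (f x)%:E).
  apply: eq_measure_integral => A mA _.
  by rewrite rhoE// -[RHS]/(measure_add _ _ A) measure_addE.
by rewrite ge0_integral_measure_add// !ge0_integral_mscale.
Qed.

End BorelIntegrals.

(** * Linear functionals below [l] and the measures they induce *)

Section SublinearRepresentation.
Context {R : realType} {E : ptopologicalType}.
Hypothesis hE : lchs E.
Variable l : (E -> R) -> R.
Hypothesis l_ge0 : forall f, USC f -> 0 <= l f.
Hypothesis l_mono : forall f g, USC f -> USC g -> (forall x, f x <= g x) -> l f <= l g.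
Hypothesis l_add : forall f g, USC f -> USC g -> l (fun x => f x + g x) <= l f + l g.
Hypothesis l_scale : forall c f, 0 < c -> USC f -> l (fun x => c * f x) <= c * l f.
Hypothesis l_step : forall (K : nat -> set E) (C : nat -> nat -> set E) d n b, 0 < d ->
  (forall k, compact (K k)) -> (forall k, K k.+1 `<=` K k) ->
  (forall k j, compact (C k j)) -> (forall k j, C k j.+1 `<=` C k j) ->
  (forall k, \bigcap_j C k j = K k) ->
  (forall j, b <= l (step d (C ^~ j) n)) -> b <= l (step d K n).

Let V : lmodType R := E -> R^o.

(** [USC] is only a cone; domination in absolute value gives a linear space containing it. *)
Let D : set V := [set f | exists2 g : E -> R, USC g & forall x, `|f x| <= g x].

(* Dominating by upper semicontinuous functions extends [l] to all bounded
   functions with relatively compact support, including differences. *)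
Let p (f : V) : R := inf [set l g | g in [set g | USC g /\ forall x, f x <= g x]].

Let closed_compact (K : set E) : compact K -> closed K.
Proof. by have [_ hausE _] := hE; exact: compact_closed. Qed.

(** Scaling by one half gives [l 0 <= l 0 / 2], which with non-negativity forces zero. *)
Let l0 : l (fun=> 0) = 0.
Proof.
have := @l_scale 2^-1 (fun=> 0); rewrite invr_gt0 ltr0n => /(_ isT USC0).
under [X in l X]eq_fun do rewrite mulr0.
have := l_ge0 USC0; lra.
Qed.

Let D_add u v : D u -> D v -> D (u + v).
Proof.
move=> [f uf fu] [g ug gv]; exists (fun x => f x + g x); first exact: USC_add.
by move=> x; apply: le_trans (ler_normD _ _) _; rewrite lerD.
Qed.

Let D_scale a u : D u -> D (a *: u).
Proof.
(* The added [1] keeps the factor positive when [a = 0], as [USC_scale] requires. *)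
move=> [f uf fu]; exists (fun x => (`|a| + 1) * f x).
  by apply: USC_scale => //; rewrite ltr_wpDl.
move=> x; rewrite -[(a *: u) x]/(a * u x) normrM.
apply: (@le_trans _ _ (`|a| * f x)); first by rewrite ler_wpM2l.
have [f0 _ _ _] := uf; have := f0 x; rewrite mulrDl mul1r; lra.
Qed.

Let D_USC (f : E -> R) : USC f -> D f.
Proof. by move=> uf; exists f => // x; have [f0 _ _ _] := uf; rewrite ger0_norm. Qed.

Let p_le (f : V) g : USC g -> (forall x, f x <= g x) -> p f <= l g.
Proof.
move=> ug fg; apply: ge_inf; last by exists g.
by exists 0 => _ [h [uh _] <-]; exact: l_ge0.
Qed.

Let p_ge (f : V) s : D f -> (forall g, USC g -> (forall x, f x <= g x) -> s <= l g) ->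
  s <= p f.
Proof.
move=> [g ug fg] h; apply: lb_le_inf => [|_ [k [uk fk] <-]]; last exact: h.
by exists (l g), g => //; split => // x; apply: le_trans (fg x); exact: ler_norm.
Qed.

Let p_sublinear : sublinear_on D p.
Proof.
split=> [u v Du Dv|a u a0 Du].
  rewrite -lerBlDr; apply: p_ge => // g ug ul.
  rewrite lerBlDr -lerBlDl; apply: p_ge => // h uh vh.
  rewrite lerBlDl; apply: le_trans (l_add ug uh).
  by apply: p_le; [exact: USC_add|move=> x; rewrite lerD].
move: a0; rewrite le_eqVlt => /orP[/eqP<-|a0].
  by rewrite mul0r scale0r -[leRHS]l0; apply: p_le => //; exact: USC0.
rewrite -ler_pdivrMl//; apply: p_ge => // g ug ul.
rewrite ler_pdivrMl//; apply: le_trans (l_scale a0 ug).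
apply: p_le; first exact: USC_scale.
by move=> x; rewrite -[(a *: u) x]/(a * u x) ler_wpM2l// ltW.
Qed.

Section Supporting.
Variable L : V -> R.
Hypothesis L_add : forall u v, D u -> D v -> L (u + v) = L u + L v.
Hypothesis L_scale : forall a u, D u -> L (a *: u) = a * L u.
Hypothesis L_le : forall u, D u -> L u <= p u.

Let L_le_l (f : E -> R) : USC f -> L f <= l f.
Proof. by move=> uf; apply: le_trans (L_le (D_USC uf)) _; exact: p_le. Qed.

(** Domination by [p] yields positivity: [u - v] lies below the zero function, so
    [L (u - v) <= l 0 = 0]. *)
Let L_mono u v : D u -> D v -> (forall x, u x <= v x) -> L u <= L v.
Proof.
move=> Du Dv uv; have DN : D (- v) by rewrite -scaleN1r; exact: D_scale.
have : L (u - v) <= l (fun=> 0).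
  apply: le_trans (L_le (D_add Du DN)) _; apply: p_le; first exact: USC0.
  by move=> x; rewrite subr_le0.
by rewrite l0 L_add// -scaleN1r L_scale//; lra.
Qed.

Let L0 : L 0 = 0.
Proof. by have := L_scale 0 (D_USC USC0); rewrite scale0r mul0r. Qed.

Let m (K : set E) : R := L (\1_K : E -> R).

Let D_indic (K : set E) : compact K -> D (\1_K : E -> R).
Proof. by move=> cK; apply: D_USC; apply: USC_indic => //; exact: closed_compact. Qed.

Let m_ge0 (K : set E) : compact K -> 0 <= m K.
Proof.
move=> cK; rewrite -L0; apply: L_mono; [exact: (D_USC USC0)|exact: D_indic|].
by move=> x; rewrite indicE.
Qed.

Let m_mono (K C : set E) : compact K -> compact C -> K `<=` C -> m K <= m C.
Proof.
move=> cK cC KC; apply: L_mono; [exact: D_indic|exact: D_indic|move=> x].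
rewrite !indicE ler_nat; case: (boolP (x \in K)) => // /set_mem/KC Cx.
by rewrite mem_set.
Qed.

Let m_subU (K C : set E) : compact K -> compact C -> m (K `|` C) <= m K + m C.
Proof.
move=> cK cC; have [DK DC] := (D_indic cK, D_indic cC).
rewrite /m -L_add//; apply: L_mono; [|exact: D_add|move=> x].
  by apply: D_indic; exact: compactU.
rewrite -[leRHS]/(\1_K x + \1_C x) !indicE -natrD ler_nat in_setU.
by case: (x \in K); case: (x \in C).
Qed.

Let m_addU (K C : set E) : compact K -> compact C -> K `&` C = set0 ->
  m K + m C <= m (K `|` C).
Proof.
move=> cK cC KC; have [DK DC] := (D_indic cK, D_indic cC).
rewrite /m -L_add//; apply: L_mono; [exact: D_add| |move=> x].
  by apply: D_indic; exact: compactU.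
rewrite -[leLHS]/(\1_K x + \1_C x) !indicE -natrD ler_nat in_setU.
have : ~~ ((x \in K) && (x \in C)) by rewrite -in_setI KC in_set0.
by case: (x \in K); case: (x \in C).
Qed.

Let L_step d A n : 0 < d -> (forall k, compact (A k)) ->
  L (step d A n) = \sum_(k < n) d * m (A k).
Proof.
move=> d0 cA; elim: n => [|n ih].
  rewrite big_ord0 -[RHS]L0; congr L.
  by apply/funext => x; rewrite /step big_ord0.
rewrite big_ord_recr /= -ih.
have -> : step d A n.+1 = (step d A n : V) + d *: (\1_(A n) : V).
  by apply/funext => x; rewrite stepS.
rewrite L_add ?L_scale//; [exact: D_indic| |by apply: D_scale; exact: D_indic].
by apply: D_USC; apply: USC_step => // k; exact: closed_compact.
Qed.

Local Open Scope ereal_scope.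

(** Heights start at [d]: the superlevel set at height [0] would be the whole space, which need not
    be compact. *)
Let superlevel d (f : E -> R) k := [set x | (k.+1%:R * d <= f x)%R].

Let superlevel_compact d f k : (0 < d)%R -> USC f ->
  closed (superlevel d f k) /\ compact (superlevel d f k).
Proof.
move=> d0 uf; have [_ hausE _] := hE.
by apply: USC_superlevel => //; rewrite mulr_gt0// ltr0n.
Qed.

Let superlevel_dec d f k : (0 < d)%R -> superlevel d f k.+1 `<=` superlevel d f k.
Proof.
move=> d0 x; apply: le_trans.
by rewrite ler_wpM2r ?(ltW d0)// ler_nat.
Qed.

Let USC_step_approx (d : R) f : (0 < d)%R -> USC f -> exists n,
  let g := step d (superlevel d f) n in
  [/\ USC g, (forall x, g x <= f x)%R &
      forall x, (f x <= g x + d * \1_(closure [set x | f x != 0%R]) x)%R].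
Proof.
move=> d0 uf; have [f0 [M fM] _ _] := uf.
(* With this many layers the top height exceeds the bound [M] of [f], so nothing is truncated. *)
exists (Num.truncn (M / d)).+1; split.
- by apply: USC_step => // k; have [] := superlevel_compact k d0 uf.
- by move=> x; apply: step_superlevel_le => //; exact: ltW.
- move=> x; have [fx0|fx0] := eqVneq (f x) 0%R.
    by rewrite fx0 addr_ge0 ?step_ge0 ?(ltW d0)// mulr_ge0 ?(ltW d0)// indicE.
  rewrite indicE mem_set ?mulr1; last exact: subset_closure.
  apply: step_superlevel_ge => //; apply: le_trans (fM x) _.
  by rewrite -ler_pdivrMr// ltW// truncnS_gt.
Qed.

(** Both bounds are checked on step functions and carried to [f] by [USC_step_approx], whose error
    [d] on the compact closure of the support is made small after integration. *)
Lemma supporting_measure : exists mu : {measure set (borelE E) -> \bar R},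
  [/\ radon mu, (forall f, USC f -> (L f)%:E <= \int[mu]_x (f x)%:E) &
      forall f, USC f -> \int[mu]_x (f x)%:E <= (l f)%:E].
Proof.
have [mu [mu_ge mu_le]] := content_measure hE m_ge0 m_mono m_subU m_addU.
have mu_radon : radon mu.
  move=> K cK; have [W [oW KW cW]] := compact_precompact_open hE cK.
  apply: (@le_lt_trans _ _ (m (closure W))%:E); last exact: ltry.
  apply: le_trans (mu_le _ _ oW cW (@subset_closure _ _)).
  apply: le_measure => //; rewrite inE.
    by apply: closed_measurable_borelE; exact: closed_compact.
  exact: open_measurable_borelE.
have int_le f g : USC f -> USC g -> (forall x, (f x <= g x)%R) ->
    \int[mu]_x (f x)%:E <= \int[mu]_x (g x)%:E.
  move=> uf ug fg; have [[f0 _ _ _] [g0 _ _ _]] := (uf, ug).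
  apply: ge0_le_integral => //; [|exact: USC_measurable|exact: USC_measurable|].
  - by move=> x _; rewrite lee_fin.
  - by move=> x _; rewrite lee_fin.
pose S (f : E -> R) : set E := closure [set x | f x != 0%R].
have cS f : USC f -> compact (S f) by case=> _ _ _; rewrite precompactE.
have uS (d : R) f : (0 < d)%R -> USC f -> USC (fun x => (d * \1_(S f) x)%R).
  move=> d0 uf; apply: USC_scale => //; apply: USC_indic; last exact: cS.
  exact: closed_closure.
exists mu; split => // f uf.
  apply/lee_addgt0Pr => e e0.
  have mS0 : (0 < m (S f) + 1)%R by rewrite ltr_wpDl// m_ge0//; exact: cS.
  (* The error [d * m (S f)] is then at most [e]; the added [1] keeps the denominator positive. *)
  pose d := (e / (m (S f) + 1))%R.
  have d0 : (0 < d)%R by rewrite divr_gt0.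
  have [n [ug gf fg]] := USC_step_approx d0 uf.
  apply: (@le_trans _ _ (\int[mu]_x (step d (superlevel d f) n x)%:E + e%:E)); last first.
    by rewrite leeD2r//; exact: int_le.
  have cK k := (superlevel_compact k d0 uf).2.
  rewrite integral_step ?(ltW d0)//; last first.
    by move=> k; have [] := superlevel_compact k d0 uf.
  apply: (@le_trans _ _ (L (step d (superlevel d f) n) + d * m (S f))%:E).
    rewrite lee_fin -L_scale; last by apply: D_indic; exact: cS.
    rewrite -L_add; [|exact: D_USC|by apply: D_scale; apply: D_indic; exact: cS].
    apply: L_mono => //; first exact: D_USC.
    apply: D_add; first exact: D_USC.
    by apply: D_scale; apply: D_indic; exact: cS.
  rewrite L_step// EFinD leeD//.
    rewrite -sumEFin; apply: lee_sum => k _; rewrite EFinM.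
    by rewrite lee_pmul2l ?lte_fin// mu_ge.
  rewrite lee_fin /d -mulrA ler_piMr ?(ltW e0)// ler_pdivrMl// mulr1.
  by rewrite lerDl.
have step_le (d : R) n : (0 < d)%R ->
    \int[mu]_x (step d (superlevel d f) n x)%:E <= (l f)%:E.
  move=> d0; have cK k := superlevel_compact k d0 uf.
  have [V' VP] := choice (fun k => compact_open_enlargement hE (cK k).2).
  rewrite integral_step ?(ltW d0)//; last by move=> k; exact: (cK k).1.
  have muK_fin k : mu (superlevel d f k) \is a fin_num.
    by rewrite ge0_fin_numE// mu_radon//; exact: (cK k).2.
  have muK k : mu (superlevel d f k) = (fine (mu (superlevel d f k)))%:E.
    by rewrite fineK.
  under eq_bigr do rewrite muK -EFinM.
  rewrite sumEFin lee_fin; apply: (@le_trans _ _ (l (step d (superlevel d f) n))).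
    apply: (l_step (C := fun k j => closure (V' k j))) => //.
    - by move=> k; exact: (cK k).2.
    - by move=> k; exact: superlevel_dec.
    - by move=> k j; have [] := VP k.
    - by move=> k j; apply: closureS; have [] := VP k.
    - by move=> k; have [] := VP k.
    (* The open sets [V' k j] pass from [mu] to [m]: [mu] of a layer is at most [m] of the closure
       of [V' k j], and the sum of these contents is [L] of the enlarged step function. *)
    move=> j; have cC k : compact (closure (V' k j)) by have [] := VP k.
    apply: (@le_trans _ _ (L (step d (fun k => closure (V' k j)) n))); last first.
      by apply: L_le_l; apply: USC_step => // k; exact: closed_closure.
    rewrite L_step//; apply: ler_sum => k _; rewrite ler_pM2l//.
    rewrite -lee_fin -muK; have [oV KV cV _ _] := VP k.
    apply: le_trans (mu_le _ _ (oV j) (cV j) (@subset_closure _ _)).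
    apply: le_measure; rewrite ?inE//; last exact: open_measurable_borelE.
    by apply: closed_measurable_borelE; exact: (cK k).1.
  apply: l_mono => //.
    by apply: USC_step => // k; have [] := superlevel_compact k d0 uf.
  move=> x; apply: step_superlevel_le; first exact: ltW.
  by have [] := uf.
apply/lee_addgt0Pr => e e0.
have muS_fin : mu (S f) \is a fin_num.
  by rewrite ge0_fin_numE// mu_radon//; exact: cS.
pose c := fine (mu (S f)).
have c0 : (0 < c + 1)%R by rewrite ltr_wpDl// fine_ge0.
pose d := (e / (c + 1))%R.
have d0 : (0 < d)%R by rewrite divr_gt0.
have [n [ug gf fg]] := USC_step_approx d0 uf.
apply: (@le_trans _ _ (\int[mu]_x
    ((step d (superlevel d f) n x)%:E + (d * \1_(S f) x)%:E))).
  under [leRHS]eq_integral do rewrite -EFinD.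
  by apply: int_le => //; apply: USC_add => //; exact: uS.
rewrite ge0_integralD//; first last.
- by apply: USC_measurable; exact: uS.
- by move=> x _; rewrite lee_fin mulr_ge0 ?(ltW d0)// indicE.
- exact: USC_measurable.
- by move=> x _; rewrite lee_fin step_ge0// ltW.
apply: leeD; first exact: step_le.
(* The error term is a step function with the single layer [S f]. *)
have := @integral_step _ _ mu d (fun=> S f) 1 (ltW d0) (fun=> @closed_closure _ _).
rewrite big_ord1 /step.
under eq_integral do rewrite big_ord1.
move=> ->; rewrite -(fineK muS_fin) -/c -EFinM lee_fin.
rewrite /d -mulrA ler_piMr ?(ltW e0)// ler_pdivrMl// mulr1.
by rewrite lerDl.
Qed.

End Supporting.

(** Monotonicity gives [l f0 <= p f0 = L f0], and the two bounds of [supporting_measure] enclose the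
    integral of [f0] between [L f0] and [l f0]. *)
Lemma sublinear_attained (f0 : E -> R) : USC f0 ->
  exists mu : {measure set (borelE E) -> \bar R},
  [/\ radon mu, (forall f, USC f -> (\int[mu]_x (f x)%:E <= (l f)%:E)%E) &
      (\int[mu]_x (f0 x)%:E)%E = (l f0)%:E].
Proof.
move=> uf0; have [L [LD LZ Lp Lf0]] :=
  hahn_banach_on D_add D_scale p_sublinear (D_USC uf0).
have [mu [rmu muL mul]] := supporting_measure LD LZ Lp.
exists mu; split => //; apply/eqP; rewrite eq_le mul//=.
apply: le_trans (muL _ uf0); rewrite lee_fin Lf0.
by apply: p_ge; [exact: D_USC|move=> g ug fg; exact: l_mono].
Qed.

End SublinearRepresentation.

(** * Tail dependence functionals *)

Section TailDependence.
Context {R : realType} {E : ptopologicalType} {dO : measure_display}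
  {O : measurableType dO}.
Variables (P : probability O R) (X : O -> set E -> \bar R) (l : (E -> R) -> R).
Hypothesis hE : lchs E.
Hypothesis hX : forall w, sup_measure (X w).
Hypothesis hl : tail_dependence P X l.
Implicit Types f g : E -> R.

Lemma tail_dependence_ge0 f : USC f -> 0 <= l f.
Proof. by move=> /hl[]. Qed.

Lemma tail_dependence_mono f g : USC f -> USC g -> (forall x, f x <= g x) ->
  l f <= l g.
Proof.
move=> uf ug fg; apply: (frechet_scale_mono _ (hl uf) (hl ug)) => w.
exact: ext_integral_le.
Qed.

Lemma tail_dependence_add f g : USC f -> USC g ->
  l (fun x => f x + g x) <= l f + l g.
Proof.
move=> uf ug; apply: (frechet_scale_subadd _ (hl uf) (hl ug)
  (hl (USC_add uf ug))) => w.
by apply: ext_integral_add => //; [case: uf|case: ug].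
Qed.

Lemma tail_dependence_scale c f : 0 < c -> USC f ->
  l (fun x => c * f x) <= c * l f.
Proof.
move=> c0 uf; apply: (frechet_scale_mono _ (hl (USC_scale c0 uf))
  (frechet_scaleM c0 (hl uf))) => w.
by apply: ext_integral_scale => //; case: uf.
Qed.

(** Outer continuity holds for each [w] by [ext_integral_step_enlarge], and [frechet_scale_semicont]
    transfers it to the scales. *)
Lemma tail_dependence_step (K : nat -> set E) (C : nat -> nat -> set E) d n b :
  0 < d -> (forall k, compact (K k)) -> (forall k, K k.+1 `<=` K k) ->
  (forall k j, compact (C k j)) -> (forall k j, C k j.+1 `<=` C k j) ->
  (forall k, \bigcap_j C k j = K k) ->
  (forall j, b <= l (step d (C ^~ j) n)) -> b <= l (step d K n).
Proof.
move=> d0 cK Kdec cC Cdec capC bl; have [_ hausE _] := hE.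
have uC j : USC (step d (C ^~ j) n).
  by apply: USC_step => // k; exact: compact_closed.
have uK : USC (step d K n).
  by apply: USC_step => // k; exact: compact_closed.
apply: (frechet_scale_semicont (hl uK)
  (Z := fun j w => ext_integral (step d (C ^~ j) n) (X w))).
- by move=> j; exists (l (step d (C ^~ j) n)) => //; exact: hl.
- move=> w j; apply: ext_integral_le => // x; apply: ler_sum => k _.
  rewrite ler_pM2l// !indicE ler_nat; case: (boolP (x \in C k j.+1)) => //.
  by move=> /set_mem/Cdec Cx; rewrite mem_set.
- move=> w s t s0 st Ys.
  by apply: (ext_integral_step_enlarge hE (hX w) d0 cK) Ys => //; rewrite s0.
Qed.

End TailDependence.

(** * Convexity of the dominated measures and the supremum formula *)

Unset Implicit Arguments. Set Strict Implicit. Set Printing Implicit Defensive.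
Local Open Scope ereal_scope.

Theorem mainTheorem11 (R : realType) (E : ptopologicalType)
  (dO : measure_display) (O : measurableType dO) (P : probability O R)
  (X : O -> set E -> \bar R) (l : (E -> R) -> R) :
  lchs E -> random_sup_measure X -> max_stable P X -> tail_dependence P X l ->
  let M := [set mu : {measure set (borelE E) -> \bar R} | radon mu /\
              forall f : E -> R, USC f -> \int[mu]_x (f x)%:E <= (l f)%:E] in
  convex_measures M /\
  forall f : E -> R, USC f ->
    ereal_sup [set \int[mu]_x (f x)%:E | mu in M] = (l f)%:E.
Proof.
move=> hE [hX _ _] _ hl M; have [_ hausE _] := hE; split.
  move=> mu nu rho a [rmu Mmu] [rnu Mnu] a01 rhoE.
  have [a0 b0] : (0 <= a /\ 0 <= 1 - a)%R by lra.
  split=> [K cK|f uf].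
    rewrite rhoE; last by apply: closed_measurable_borelE; exact: compact_closed.
    by rewrite lte_add_pinfty// lte_mul_pinfty// ?lee_fin//; [exact: rmu|exact: rnu].
  rewrite (integral_convex a01 uf rhoE).
  have -> : (l f)%:E = a%:E * (l f)%:E + (1 - a)%:E * (l f)%:E.
    by rewrite -!EFinM -EFinD; congr EFin; ring.
  by rewrite leeD// lee_wpmul2l ?lee_fin//; [exact: Mmu|exact: Mnu].
move=> f uf; apply/eqP; rewrite eq_le; apply/andP; split.
  by apply: ge_ereal_sup => _ [mu [_ Mmu] <-]; exact: Mmu.
(* The supremum is attained, at a measure supporting [l] at [f]. *)
have [mu [rmu Mmu <-]] := sublinear_attained hE (tail_dependence_ge0 hl)
  (tail_dependence_mono hX hl) (tail_dependence_add hE hX hl)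
  (tail_dependence_scale hE hX hl) (tail_dependence_step hE hX hl) uf.
by apply: ereal_sup_ubound; exists mu.
Qed.
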